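(* For every integer $N\ge 1$, the cosine measure of the set $D_2\subset\mathbb{R}^N$ is $$\mathrm{cm}(D_2)=\frac{1}{\sqrt{N}}.$$
   Context: For a finite set $D\subset\mathbb{R}^N$ that positively spans $\mathbb{R}^N$ (every vector of $\mathbb{R}^N$ is a linear combination of elements of $D$ with nonnegative coefficients), the cosine measure is $$\mathrm{cm}(D)=\min_{0\neq v\in\mathbb{R}^N}\ \max_{0\neq d\in D}\ \frac{v^T d}{\|v\|_2\,\|d\|_2}.$$ The set $D_2$ is $$D_2=\Big\{d^{(k)}\in\mathbb{R}^N \ :\ d^{(k)}_l=2\big([\mathrm{radix}_2(k)]_l-\tfrac12\big),\ 1\le l\le N,\ 0\le k\le 2^N-1\Big\},$$ where $\mathrm{radix}_2(k)\in\{0,1\}^N$ is the vector of the $N$ base-2 digits of the integer $k$ and $[\mathrm{radix}_2(k)]_l$ its $l$-th component. Equivalently, $D_2=\{-1,1\}^N$. *)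

(* Defs.v *)
From mathcomp Require Import all_boot all_order all_algebra.
From mathcomp Require Import finmap.
From mathcomp Require Import classical_sets reals.

Set Implicit Arguments.
Unset Strict Implicit.
Unset Printing Implicit Defensive.

Import Order.TTheory GRing.Theory Num.Theory.
Local Open Scope classical_set_scope.
Local Open Scope ring_scope.

(* The greatest (resp. least) element of A; it is required to belong to A.
   The value is 0 by convention when there is no such element. *)
Definition set_max (R : realType) (A : set R) : R := xget 0 (A `&` ubound A).
Definition set_min (R : realType) (A : set R) : R := xget 0 (A `&` lbound A).

Lemma set_maxP (R : realType) (A : set R) (m : R) :
  A m -> ubound A m -> set_max A = m.
Proof.
move=> Am ubm; apply: xget_subset1; first by split.
by move=> x y [Ax ubx] [Ay uby]; apply/le_anti; rewrite uby// ubx.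
Qed.

Lemma set_minP (R : realType) (A : set R) (m : R) :
  A m -> lbound A m -> set_min A = m.
Proof.
move=> Am lbm; apply: xget_subset1; first by split.
by move=> x y [Ax lbx] [Ay lby]; apply/le_anti; rewrite lbx// lby.
Qed.

Definition dotv (R : realType) (N : nat) (v d : 'cV[R]_N) : R :=
  (v^T *m d) 0 0.

(* The norm that the analysis library puts on matrices is the sup norm, so the
   Euclidean norm has to be defined separately. *)
Definition norm2 (R : realType) (N : nat) (v : 'cV[R]_N) : R :=
  Num.sqrt (\sum_(l < N) v l 0 ^+ 2).

Definition positively_spans (R : realType) (N : nat)
    (D : {fset 'cV[R]_N}) : Prop :=
  forall v : 'cV[R]_N, exists c : 'cV[R]_N -> R,
    (forall d, d \in D -> 0 <= c d) /\ v = \sum_(d <- D) c d *: d.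

Record posSpanSet (R : realType) (N : nat) := PosSpanSet {
  pss_set :> {fset 'cV[R]_N};
  pss_spans : positively_spans pss_set }.

Definition cosine (R : realType) (N : nat) (v d : 'cV[R]_N) : R :=
  dotv v d / (norm2 v * norm2 d).

Definition cosine_measure (R : realType) (N : nat) (D : posSpanSet R N) : R :=
  set_min [set set_max [set cosine v d | d in [set d | d \in pss_set D /\ d != 0]]
          | v in [set v : 'cV[R]_N | v != 0]].

(* Least significant digit first; digits of weight 2 ^ N and above are
   dropped. *)
Definition radix2 (N k : nat) : 'cV[nat]_N :=
  \col_(l < N) (k %/ 2 ^ l %% 2)%N.

Definition D2_vec (R : realType) (N k : nat) : 'cV[R]_N :=
  \col_(l < N) (2 * ((radix2 N k l 0)%:R - 1 / 2)).

Definition D2_set (R : realType) (N : nat) : {fset 'cV[R]_N} :=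
  [fset D2_vec R N (val k) | k in 'I_(2 ^ N)]%fset.

Lemma radix2_surj (N : nat) (b : nat -> bool) :
  exists2 k, (k < 2 ^ N)%N & forall l, (l < N)%N -> (k %/ 2 ^ l %% 2)%N = b l.
Proof.
elim: N b => [|N IHN] b; first by exists 0%N.
have [k ltk Hk] := IHN (fun l => b l.+1).
exists (b 0%N + k.*2)%N.
  by rewrite expnS mul2n; case: (b 0%N);
    rewrite ?add0n ?add1n ?ltn_double ?ltn_Sdouble.
case=> [_|l ltl]; first by rewrite expn0 divn1 modn2 oddD odd_double addbF oddb.
rewrite expnS divnMA divn2 half_bit_double; exact: Hk.
Qed.

Lemma mem_D2P (R : realType) (N : nat) (d : 'cV[R]_N) :
  reflect (forall l, d l 0 = 1 \/ d l 0 = -1) (d \in D2_set R N).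
Proof.
have two0 : (2 : R) != 0 by rewrite pnatr_eq0.
apply: (iffP idP) => [/imfsetP[k _ ->] l|Hd].
  rewrite !mxE modn2 mulrBr mul1r mulfV//.
  by case: odd; [left|right]; rewrite ?mulr1 ?mulr0 ?add0r// mulr2n addrK.
have [k ltk Hk] := radix2_surj N
  (fun l => if insub l is Some i then d i 0 == 1 else false).
apply/imfsetP; exists (Ordinal ltk) => //.
apply/matrixP => l j; rewrite ord1 !mxE Hk// valK mulrBr mul1r mulfV//.
case: eqP => [->|]; first by rewrite mulr1 mulr2n addrK.
by case: (Hd l) => -> // _; rewrite mulr0 add0r.
Qed.

Lemma D2_spans (R : realType) (N : nat) : positively_spans (D2_set R N).
Proof.
set D := D2_set R N.
pose combo (v : 'cV[R]_N) := exists c : 'cV[R]_N -> R,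
  (forall d, d \in D -> 0 <= c d) /\ v = \sum_(d <- D) c d *: d.
have combo0 : combo 0.
  by exists (fun=> 0); split=> //; rewrite big1// => d _; rewrite scale0r.
have comboD u v : combo u -> combo v -> combo (u + v).
  move=> [a [a0 ->]] [b [b0 ->]]; exists (fun d => a d + b d); split.
    by move=> d dD; rewrite addr_ge0 ?a0 ?b0.
  by rewrite -big_split; apply: eq_bigr => d _; rewrite scalerDl.
have comboZ t u : 0 <= t -> combo u -> combo (t *: u).
  move=> t0 [a [a0 ->]]; exists (fun d => t * a d); split.
    by move=> d dD; rewrite mulr_ge0 ?a0.
  by rewrite scaler_sumr; apply: eq_bigr => d _; rewrite scalerA.
have comboD2 u : u \in D -> combo u.
  move=> uD; exists (fun d => (d == u)%:R); split=> //.
  rewrite (bigD1_seq u)//= eqxx scale1r big1 ?addr0// => d /negPf ->.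
  by rewrite scale0r.
(* s e_l = (x + y) / 2 where x has all entries s and y = 2 s e_l - x *)
have comboE (s : R) (l : 'I_N) : s = 1 \/ s = -1 ->
    combo (s *: delta_mx l 0).
  move=> Hs; have -> : s *: delta_mx l 0 = 2^-1 *: (const_mx s
      + (\col_(i < N) (if i == l then s else - s))) :> 'cV[R]_N.
    apply/matrixP => i j; rewrite ord1 !mxE eqxx andbT.
    case: (i == l); last by rewrite addrN !mulr0.
    by rewrite -mulr2n -[s *+ 2]mulr_natl mulrA mulVf ?pnatr_eq0// mul1r mulr1.
  apply: comboZ; first by rewrite invr_ge0.
  apply: comboD; apply: comboD2; apply/mem_D2P => i; rewrite !mxE//.
  by case: (i == l) => //; case: Hs => ->; [right|left]; rewrite ?opprK.
move=> v; change (combo v).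
have -> : v = \sum_(l < N) v l 0 *: delta_mx l 0.
  apply/matrixP => i j; rewrite ord1 summxE (bigD1 i)//= !mxE !eqxx mulr1.
  rewrite big1 ?addr0// => l /negPf li.
  by rewrite !mxE [i == l]eq_sym li mulr0.
elim/big_ind : _ => // l _.
case: (lerP 0 (v l 0)) => v0.
  by apply: comboZ => //; rewrite -[delta_mx _ _]scale1r; apply: comboE; left.
rewrite -[v l 0]opprK -mulrN1 -scalerA; apply: comboZ.
  by rewrite oppr_ge0 ltW.
by apply: comboE; right.
Qed.

Definition D2 (R : realType) (N : nat) : posSpanSet R N :=
  PosSpanSet (@D2_spans R N).

(* Main.v *)
(* For v <> 0 the maximal cosine over {-1,1}^N is attained at the sign vector
   of v and equals |v|_1 / (|v|_2 sqrt N); since |v|_2 <= |v|_1 with equality at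
   a basis vector, the least such value is 1 / sqrt N. *)
Require Import Defs.
From mathcomp Require Import all_boot all_order all_algebra.
From mathcomp Require Import reals.
From mathcomp Require Import finmap classical_sets.
Import Order.TTheory GRing.Theory Num.Theory.
Local Open Scope ring_scope.

Lemma dotvE (R : realType) (N : nat) (v d : 'cV[R]_N) :
  dotv v d = \sum_(l < N) v l 0 * d l 0.
Proof. by rewrite /dotv mxE; apply: eq_bigr => l _; rewrite mxE. Qed.

Lemma norm2_gt0 (R : realType) (N : nat) (v : 'cV[R]_N) :
  v != 0 -> 0 < norm2 v.
Proof.
move=> v0; rewrite sqrtr_gt0 lt0r sumr_ge0 ?andbT => [|l _]; last exact: sqr_ge0.
apply: contraNneq v0 => /eqP; rewrite psumr_eq0 => [/allP v0|l _]; last exact: sqr_ge0.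
apply/eqP/matrixP => i j; rewrite ord1 mxE; apply/eqP.
by have := v0 i (mem_index_enum i); rewrite sqrf_eq0.
Qed.

(** Squaring the sum of absolute values yields the sum of squares plus nonnegative cross terms. The
    induction also carries nonnegativity of the partial sum, which the sign of the new cross term
    requires. *)
Lemma norm2_le_norm1 (R : realType) (N : nat) (v : 'cV[R]_N) :
  norm2 v <= \sum_(l < N) `|v l 0|.
Proof.
suff [s0 le_s] : 0 <= \sum_(l < N) `|v l 0| /\
    \sum_(l < N) v l 0 ^+ 2 <= (\sum_(l < N) `|v l 0|) ^+ 2.
  by rewrite -[leRHS]ger0_norm// -sqrtr_sqr ler_wsqrtr.
elim/big_rec2: _ => [|l x y _ [x0 le_yx]]; first by rewrite expr0n.
split; first by rewrite addr_ge0.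
rewrite sqrrD real_normK ?num_real// -addrA lerD2l.
by apply: le_trans le_yx _; rewrite lerDr mulrn_wge0 ?mulr_ge0.
Qed.

Lemma norm2_D2 (R : realType) (N : nat) (d : 'cV[R]_N) :
  d \in D2_set R N -> norm2 d = Num.sqrt N%:R.
Proof.
move=> /mem_D2P Hd; rewrite /norm2 (eq_bigr (fun=> 1)) ?sumr_const ?card_ord//.
by move=> l _; case: (Hd l) => ->; rewrite ?sqrrN expr1n.
Qed.

Lemma max_cosine_D2 (R : realType) (N : nat) (v : 'cV[R]_N) :
  (0 < N)%N -> v != 0 ->
  set_max [set cosine v d | d in [set d | d \in D2_set R N /\ d != 0]]%classic
  = (\sum_(l < N) `|v l 0|) / (norm2 v * Num.sqrt N%:R).
Proof.
move=> N0 v0; apply: set_maxP.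
  (* Zero entries of [v] get the sign 1, so that [d] stays in {-1,1}^N. *)
  pose d : 'cV[R]_N := \col_l (if 0 <= v l 0 then 1 else -1).
  have dD : d \in D2_set R N.
    by apply/mem_D2P => l; rewrite mxE; case: ifP; [left|right].
  exists d; last first.
    rewrite /cosine (norm2_D2 _ _ _ dD) dotvE; congr (_ / _); apply: eq_bigr => l _.
    by rewrite mxE; case: (ger0P (v l 0)) => _; rewrite ?mulr1 ?mulrN1.
  split=> //; apply/eqP => /matrixP/(_ (Ordinal N0) 0)/eqP; rewrite !mxE.
  by case: ifP; rewrite ?oppr_eq0 oner_eq0.
move=> _ [d [dD _] <-]; rewrite /cosine (norm2_D2 _ _ _ dD) dotvE.
(* All vectors of [D2_set] have norm sqrt N, so the denominators agree and the numerators compare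
   termwise: [v l 0 * d l 0] is at most its absolute value. *)
rewrite ler_wpM2r ?invr_ge0 ?mulr_ge0 ?sqrtr_ge0//.
apply: ler_sum => l _; have /mem_D2P/(_ l) := dD.
by case=> ->; rewrite ?mulr1 ?mulrN1 ?ler_norm// -normrN ler_norm.
Qed.

Theorem theorem2 (R : realType) (N : nat) (hN : (1 <= N)%N) :
  cosine_measure (D2 R N) = 1 / Num.sqrt (N%:R : R).
Proof.
have sN0 : 0 < Num.sqrt (N%:R : R) by rewrite sqrtr_gt0 ltr0n.
apply: set_minP; last first.
  (* With the factor 1 / sqrt N split off, it remains to see that |v|_1 / |v|_2 is at least 1. *)
  move=> _ [v v0 <-]; rewrite /= max_cosine_D2// invfM mulrA.
  by rewrite ler_wpM2r ?invr_ge0 ?sqrtr_ge0// ler_pdivlMr ?norm2_gt0// mul1r norm2_le_norm1.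
pose i0 := Ordinal hN; pose e : 'cV[R]_N := delta_mx i0 0.
(* Used twice: with the absolute value for |e|_1 and with the square for |e|_2. *)
have sum_e (f : R -> R) : f 0 = 0 -> \sum_(l < N) f (e l 0) = f 1.
  move=> f0; rewrite (bigD1 i0)//= mxE !eqxx big1 ?addr0// => l /negPf li.
  by rewrite mxE li.
have e0 : e != 0.
  by apply/eqP => /matrixP/(_ i0 0)/eqP; rewrite !mxE !eqxx oner_eq0.
exists e => //=; rewrite max_cosine_D2// /norm2.
rewrite (sum_e (fun x => `|x|)) ?normr0// (sum_e (fun x => x ^+ 2)) ?expr0n//.
by rewrite normr1 expr1n sqrtr1 !mul1r.
Qed.
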